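(* Let $\lambda,\mu,\theta,\gamma,c>0$ and $p\in[0,1]$, and consider the overloaded regime, in which the equilibrium $(q^*,s^* )$ of the fluid drift of the Erlang--$S^*$ model satisfies $q^*>s^*$. Then the Jacobian $J_{\mathrm{OL}}$ of the fluid drift at $(q^*,s^* )$ and the diffusion matrix $\Sigma_{\mathrm{OL}}$ at $(q^*,s^* )$ are $$J_{\mathrm{OL}}=\begin{pmatrix}-\theta&\theta-\mu\\ 0&-(\gamma+p\mu)\end{pmatrix},\qquad \Sigma_{\mathrm{OL}}=\begin{pmatrix}2\lambda&p\mu s^*\\ p\mu s^*&2p\mu s^*\end{pmatrix},$$ and the stationary covariance matrix $V_{\mathrm{OL}}=\begin{pmatrix}v_{qq}&v_{qs}\\ v_{qs}&v_{ss}\end{pmatrix}$ of the limiting Ornstein--Uhlenbeck process (whose entries are the diffusion approximations to $\mathrm{Var}(Q)$, $\mathrm{Var}(S)$, $\mathrm{Cov}(Q,S)$) is given by $$v_{qq}=\frac{\lambda}{\theta}+\frac{\theta-\mu}{\theta}\cdot\frac{c\,\gamma p\mu}{(\gamma+p\mu)^2}\cdot\frac{\gamma+\theta+p\mu-\mu}{\theta+\gamma+p\mu},\qquad v_{ss}=\frac{c\,\gamma p\mu}{(\gamma+p\mu)^2},$$ $$v_{qs}=\frac{c\,\gamma p\mu}{(\gamma+p\mu)^2}\cdot\frac{\gamma+\theta+p\mu-\mu}{\theta+\gamma+p\mu}.$$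
   Context: The fluid drift of the Erlang--$S^*$ model is $b(q,s)=\big(\lambda-\mu\min\{q,s\}-\theta(q-s)^+,\ \gamma(c-s)-p\mu\min\{q,s\}\big)^\top$, with $x^+=\max\{x,0\}$; an equilibrium is a zero of $b$. The model has the following event types, with jump vector $\ell_k$ and rate $\beta_k(q,s)$: arrival $(1,0)$, $\lambda$; service completion without charging $(-1,0)$, $(1-p)\mu\min\{q,s\}$; service completion followed by charging $(-1,-1)$, $p\mu\min\{q,s\}$; abandonment $(-1,0)$, $\theta(q-s)^+$; return from charging $(0,1)$, $\gamma(c-s)$. The diffusion matrix at $(q^*,s^* )$ is $\Sigma=\sum_k\ell_k\ell_k^\top\beta_k(q^*,s^* )$. With $J$ the Jacobian of $b$ at $(q^*,s^* )$ and $W$ a standard two-dimensional Brownian motion, the limiting Ornstein--Uhlenbeck process is $d\widehat X(t)=J\widehat X(t)\,dt+\Sigma^{1/2}dW(t)$; its stationary covariance matrix $V$ is the unique solution of the Lyapunov equation $JV+VJ^\top+\Sigma=0$. *)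

(* Defs.v *)
From HB Require Import structures.
From mathcomp Require Import all_boot all_order all_algebra.
From mathcomp Require Import all_classical all_reals all_analysis.

Set Implicit Arguments.
Unset Strict Implicit.
Unset Printing Implicit Defensive.

Import Order.TTheory GRing.Theory Num.Theory.
Import numFieldNormedType.Exports.
Local Open Scope ring_scope.

Definition vec2 (R : realType) (a b : R) : 'rV[R]_2 :=
  \row_(j < 2) (if j == 0 then a else b).

Definition mx2 (R : realType) (a b c d : R) : 'M[R]_2 :=
  \matrix_(i < 2, j < 2)
    if i == 0 then (if j == 0 then a else b) else (if j == 0 then c else d).

(* States (q, s) are row vectors, as MathComp-Analysis defines 'J f for maps
   between spaces of row vectors. *)
Notation qcoord x := (x ord0 (0 : 'I_2)).
Notation scoord x := (x ord0 (1 : 'I_2)).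

Definition drift (R : realType) (lambda mu theta gamma c p : R)
    (x : 'rV[R]_2) : 'rV[R]_2 :=
  let q := qcoord x in let s := scoord x in
  vec2 (lambda - mu * Num.min q s - theta * Num.max (q - s) 0)
       (gamma * (c - s) - p * mu * Num.min q s).

Inductive event : Set :=
  Arrival | ServiceNoCharge | ServiceThenCharge | Abandonment | ChargeReturn.

Definition events : seq event :=
  [:: Arrival; ServiceNoCharge; ServiceThenCharge; Abandonment; ChargeReturn].

Definition jump (R : realType) (k : event) : 'rV[R]_2 :=
  match k with
  | Arrival => vec2 1 0
  | ServiceNoCharge => vec2 (-1) 0
  | ServiceThenCharge => vec2 (-1) (-1)
  | Abandonment => vec2 (-1) 0
  | ChargeReturn => vec2 0 1
  end.

Definition rate (R : realType) (lambda mu theta gamma c p : R)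
    (k : event) (x : 'rV[R]_2) : R :=
  let q := qcoord x in let s := scoord x in
  match k with
  | Arrival => lambda
  | ServiceNoCharge => (1 - p) * mu * Num.min q s
  | ServiceThenCharge => p * mu * Num.min q s
  | Abandonment => theta * Num.max (q - s) 0
  | ChargeReturn => gamma * (c - s)
  end.

(* The jumps are row vectors, so the outer product l l^T of the column
   convention is (jump k)^T *m jump k. *)
Definition diffusion (R : realType) (lambda mu theta gamma c p : R)
    (x : 'rV[R]_2) : 'M[R]_2 :=
  \sum_(k <- events)
    rate lambda mu theta gamma c p k x *: ((jump R k)^T *m jump R k).

(* 'J f x acts on row vectors from the right (v *m 'J f x is the derivative
   of f along v); its transpose has the entries d f_i / d x_j. *)
Definition jacobian_mx (R : realType) (f : 'rV[R]_2 -> 'rV[R]_2)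
    (x : 'rV[R]_2) : 'M[R]_2 := ('J f x)^T.

(* V is the stationary covariance of dX = J X dt + Sigma^(1/2) dW, defined as
   the unique solution of the Lyapunov equation. *)
Definition is_stationary_cov (R : realType) (J Sigma V : 'M[R]_2) : Prop :=
  unique (fun U : 'M[R]_2 => J *m U + U *m J^T + Sigma = 0) V.

(* Main.v *)
Require Import Defs.
From HB Require Import structures.
From mathcomp Require Import all_boot all_order all_algebra.
From mathcomp Require Import all_classical all_reals all_analysis.
From mathcomp Require Import ring lra.
Import Order.TTheory GRing.Theory Num.Theory.
Import numFieldNormedType.Exports.
Local Open Scope ring_scope.

(** The overloaded equilibrium lies in the open half-plane s < q, where
    min(q, s) = s and (q - s)^+ = q - s, so near it the drift coincides with
    an affine map. A map that is affine near a point is differentiable there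
    and its linear part is the differential ([affine_near_diff]); reading off
    the coefficients gives the Jacobian ([overloaded_jacobian]).

    The two equations b(q, s) = 0, namely lambda = mu s + theta (q - s) and
    gamma (c - s) = p mu s, say that the total outflow of each coordinate
    equals its inflow. Hence the diagonal of the diffusion matrix is twice the
    inflow, and its off-diagonal entry only sees the one event that moves both
    coordinates, service followed by charging ([overloaded_diffusion]).

    The Jacobian is upper triangular with negative diagonal, so the Lyapunov
    equation is solved by back substitution: the (1,1) entry determines the
    variance of S, then each off-diagonal entry its covariance with Q, then
    the (0,0) entry the variance of Q. At every stage the coefficient of the
    unknown is a sum of two eigenvalues, hence nonzero, which yields existence
    and uniqueness at once ([lyapunov_upper_triangular]). Substituting
    s = c gamma / (gamma + p mu) gives the stated formulas. *)

(** * Maps that are affine near a point *)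

(** The remainder of the affine approximation vanishes near [x], so it is a
    little-o for a trivial reason. *)
Lemma affine_near_diff (R : numFieldType) (V W : normedModType R)
    (f : V -> W) (df : {linear V -> W}) (x : V) :
  continuous df ->
  (\forall y \near x, f y = f x + df (y - x)) ->
  differentiable f x /\ 'd f x = df :> (V -> W).
Proof.
move=> dfc fE.
have approx : f \o shift x = cst (f x) + (df : V -> W) +o_ 0 (@id V).
  apply/eqaddoP => _/posnumP[e].
  move: fE; rewrite (near_shift 0 x) subr0 !near_simpl.
  apply: filterS => h /=; rewrite addrK => fhE.
  rewrite -[X in `|X|]/(f (h + x) - (f x + df h)) fhE subrr normr0.
  exact: mulr_ge0.
have dE := diff_unique dfc approx.
by split=> //; apply/diff_locallyP; rewrite dE.
Qed.

Lemma mulmxr_continuous (R : numFieldType) (m n : nat) (A : 'M[R]_(m, n)) :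
  continuous (fun v : 'rV[R]_m => v *m A).
Proof.
rewrite (_ : (fun v : 'rV[R]_m => v *m A) =
             \sum_i (fun v : 'rV[R]_m => v ord0 i *: row i A)); last first.
  by apply/funext => v; rewrite fct_sumE mulmx_sum_row.
move=> v; apply: differentiable_continuous.
apply: differentiable_sum => i; apply: differentiableZl.
exact: differentiable_coord.
Qed.

(** * Two-by-two matrices *)

Lemma mx2P (T : Type) (A B : 'M[T]_2) :
  [/\ A 0 0 = B 0 0, A 0 1 = B 0 1, A 1 0 = B 1 0 & A 1 1 = B 1 1] <-> A = B.
Proof.
split=> [[? ? ? ?]|-> //]; apply/matrixP => i j.
have ord2 (k : 'I_2) : k = 0 \/ k = 1.
  by case: k => [[|[|//]]] k2; [left|right]; exact: val_inj.
by case: (ord2 i) => ->; case: (ord2 j) => ->.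
Qed.

Lemma mulmx2E (R : pzSemiRingType) (m n : nat)
    (A : 'M[R]_(m, 2)) (B : 'M[R]_(2, n)) i j :
  (A *m B) i j = A i 0 * B 0 j + A i 1 * B 1 j.
Proof.
have lift1 : lift ord0 ord0 = 1 :> 'I_2 by apply: val_inj.
by rewrite mxE big_ord_recl big_ord1 lift1.
Qed.

(** * The Lyapunov equation of a triangular drift *)

(** Back substitution: the entries (1,1), (0,1), (1,0), (0,0) of the equation
    have leading coefficients -2k, -(a + k), -(a + k), -2a and otherwise involve
    only entries of the unknown determined before. A solution is
    symmetric because, with a symmetric noise matrix, the equations (0,1) and
    (1,0) are the same equation in their respective unknowns. *)
Lemma lyapunov_upper_triangular (R : realType) (a d k s11 s12 s22 : R) :
  0 < a -> 0 < k ->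
  let v22 := s22 / (2 * k) in
  let v12 := (s12 + d * v22) / (a + k) in
  let v11 := (s11 + 2 * d * v12) / (2 * a) in
  is_stationary_cov (mx2 (- a) d 0 (- k)) (mx2 s11 s12 s12 s22)
    (mx2 v11 v12 v12 v22).
Proof.
move=> a_gt0 k_gt0 v22 v12 v11.
have a0 : a != 0 by rewrite gt_eqF.
have k0 : k != 0 by rewrite gt_eqF.
have ak0 : a + k != 0 by rewrite gt_eqF// addr_gt0.
split=> [|U].
  apply/mx2P; rewrite !(mulmx2E, mxE) /=; split; rewrite /v11 /v12 /v22; field;
  by rewrite ?a0 ?k0 ?ak0.
move=> /mx2P; rewrite !(mulmx2E, mxE) /= => -[E00 E01 E10 E11].
have k20 : 2 * k != 0 by rewrite mulf_neq0 ?pnatr_eq0.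
have a20 : 2 * a != 0 by rewrite mulf_neq0 ?pnatr_eq0.
have U11 : v22 = U 1 1 by apply: (canLR (mulfK k20)); lra.
have U10 : v12 = U 1 0 by apply: (canLR (mulfK ak0)); rewrite U11; lra.
have U01 : v12 = U 0 1 by apply: (canLR (mulfK ak0)); rewrite U11; lra.
have U00 : v11 = U 0 0.
  by apply: (canLR (mulfK a20)); move: E00; rewrite -U10 -U01; lra.
by apply/mx2P; rewrite !mxE.
Qed.

(** * The overloaded regime of the Erlang-S* model *)

(** The condition s < q is open, so it persists near (q, s); there the minimum
    and the positive part in the drift are resolved and the drift is affine. *)
Lemma overloaded_jacobian (R : realType) (lambda mu theta gamma c p q s : R) :
  s < q ->
  let b := drift lambda mu theta gamma c p in
  differentiable b (vec2 q s) /\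
  jacobian_mx b (vec2 q s) =
    mx2 (- theta) (theta - mu) 0 (- (gamma + p * mu)).
Proof.
move=> sq b; set x := vec2 q s; set J := mx2 _ _ _ _.
have near_overloaded : \forall y \near x, scoord (y : 'rV[R]_2) < qcoord y.
  have near_qs : \forall y \near x, 0 < qcoord (y : 'rV[R]_2) - scoord y.
    have : {for x, continuous (fun y : 'rV[R]_2 => qcoord y - scoord y)}.
      apply: differentiable_continuous; apply: differentiableB;
      exact: differentiable_coord.
    by move=> /cvgr_gt; apply; rewrite !mxE /= subr_gt0.
  by apply: filterS near_qs => y; rewrite subr_gt0.
have b_affine : \forall y \near x, b y = b x + mulmxr J^T (y - x).
  apply: filterS near_overloaded => y sy.
  have minE (u v : R) : v < u -> Num.min u v = v by move=> /ltW/min_r.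
  have maxE (u v : R) : v < u -> Num.max (u - v) 0 = u - v.
    by move=> uv; apply/max_l; rewrite subr_ge0 ltW.
  apply/rowP => j; rewrite [RHS]mxE /= mulmx2E /b /drift !mxE /=.
  rewrite !minE// !maxE//.
  case: j => [[|[|//]]] ? /=.
    ring.
  ring.
have [|b_diff dbE] := affine_near_diff _ _ _ _ _ _ _ b_affine.
  exact: mulmxr_continuous.
split=> //; rewrite /jacobian_mx /jacobian.
apply/trmx_inj; rewrite trmxK.
by apply/row_matrixP => i; rewrite !rowE mul_rV_lin1 dbE.
Qed.

(** The equilibrium equations are used as balance laws: the total outflow
    mu s + theta (q - s) from the first coordinate is lambda, and the inflow
    gamma (c - s) to the second is p mu s. *)
Lemma overloaded_diffusion (R : realType) (lambda mu theta gamma c p q s : R) :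
  drift lambda mu theta gamma c p (vec2 q s) = 0 -> s < q ->
  diffusion lambda mu theta gamma c p (vec2 q s) =
    mx2 (2 * lambda) (p * mu * s) (p * mu * s) (2 * p * mu * s).
Proof.
move=> /rowP b0 sq; move: (b0 0) (b0 1).
rewrite /drift !mxE /= (min_r (ltW sq)) max_l ?subr_ge0 ?ltW// => bq bs.
apply/mx2P; rewrite /diffusion /events !big_cons big_nil.
rewrite /rate !(mxE, big_ord1) /= (min_r (ltW sq)) max_l ?subr_ge0 ?ltW//.
by split; lra.
Qed.

Theorem theorem4p3 (R : realType) (lambda mu theta gamma c p : R)
    (lambda_gt0 : 0 < lambda) (mu_gt0 : 0 < mu) (theta_gt0 : 0 < theta)
    (gamma_gt0 : 0 < gamma) (c_gt0 : 0 < c) (p_ge0 : 0 <= p) (p_le1 : p <= 1)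
    (q s : R)
    (equilibrium : drift lambda mu theta gamma c p (vec2 q s) = 0)
    (overloaded : s < q) :
  let b := drift lambda mu theta gamma c p in
  let x := vec2 q s in
  let J := jacobian_mx b x in
  let Sigma := diffusion lambda mu theta gamma c p x in
  let v_ss := c * gamma * p * mu / (gamma + p * mu) ^+ 2 in
  let v_qs := c * gamma * p * mu / (gamma + p * mu) ^+ 2 *
              ((gamma + theta + p * mu - mu) / (theta + gamma + p * mu)) in
  let v_qq := lambda / theta +
              (theta - mu) / theta *
              (c * gamma * p * mu / (gamma + p * mu) ^+ 2) *
              ((gamma + theta + p * mu - mu) / (theta + gamma + p * mu)) in
  [/\ differentiable b x,
      J = mx2 (- theta) (theta - mu)
              0         (- (gamma + p * mu)),
      Sigma = mx2 (2 * lambda)   (p * mu * s)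
                  (p * mu * s)   (2 * p * mu * s) &
      is_stationary_cov J Sigma (mx2 v_qq v_qs v_qs v_ss)].
Proof.
move=> b x J Sigma v_ss v_qs v_qq.
have [b_diff JE] := overloaded_jacobian _ lambda mu theta gamma c p q s overloaded.
have SigmaE :=
  overloaded_diffusion _ lambda mu theta gamma c p q s equilibrium overloaded.
split=> //; rewrite /J /Sigma JE SigmaE.
have k_gt0 : 0 < gamma + p * mu by rewrite ltr_wpDr// mulr_ge0// ltW.
have k0 : gamma + p * mu != 0 by rewrite gt_eqF.
have theta0 : theta != 0 by rewrite gt_eqF.
have sum0 : theta + gamma + p * mu != 0 by rewrite -addrA gt_eqF// addr_gt0.
(* The second coordinate of the equilibrium equation is linear in s alone. *)
have sE : s = c * gamma / (gamma + p * mu).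
  have /rowP/(_ 1) := equilibrium; rewrite /drift !mxE /= (min_r (ltW overloaded)).
  by move=> bs; apply/esym/(canLR (mulfK k0)); lra.
have := lyapunov_upper_triangular _ theta (theta - mu) (gamma + p * mu)
  (2 * lambda) (p * mu * s) (2 * p * mu * s) theta_gt0 k_gt0.
congr (is_stationary_cov _ _ _).
by congr mx2; rewrite /v_qq /v_qs /v_ss sE; field; rewrite ?theta0 ?k0 ?addrA ?sum0.
Qed.
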